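(* Let $(N,\mu,\nu)$ be an intuitionistic fuzzy normed space, let $(u_k)_{k\ge 1}$ be a sequence in $N$, let $a\in N$ and let $m\ge 1$ be an integer. If $(u_k)$ is statistically $(H,m)$ summable to $a$ and the sequence $\{k(u_k-u_{k-1})\}$ is q-bounded, then $(u_k)$ is convergent to $a$ in $(N,\mu,\nu)$.
   Context: An intuitionistic fuzzy normed space (IFNS) is a triple $(N,\mu,\nu)$ where $N$ is a real vector space with zero vector $\theta$ and $\mu,\nu:N\times\mathbb{R}\to[0,1]$ satisfy, for all $u,w\in N$ and $t,s\in\mathbb{R}$: (a) $\mu(u,t)=0$ for $t\le 0$; (b) $\mu(u,t)=1$ for all $t>0$ if and only if $u=\theta$; (c) $\mu(cu,t)=\mu(u,t/|c|)$ for all $t>0$ and real $c\ne 0$; (d) $\mu(u+w,t+s)\ge\min\{\mu(u,t),\mu(w,s)\}$; (e) $\lim_{t\to\infty}\mu(u,t)=1$, and $\lim_{t\to 0}\mu(u,t)=0$ if $u\neq\theta$; (f) $\nu(u,t)=1$ for $t\le 0$; (g) $\nu(u,t)=0$ for all $t>0$ if and only if $u=\theta$; (h) $\nu(cu,t)=\nu(u,t/|c|)$ for all $t>0$ and real $c\neq 0$; (i) $\max\{\nu(u,t),\nu(w,s)\}\ge\nu(u+w,t+s)$; (j) $\lim_{t\to\infty}\nu(u,t)=0$, and $\lim_{t\to0}\nu(u,t)=1$ if $u\ne\theta$. A sequence $(u_k)$ in $N$ is convergent to $a\in N$ if for every $\varepsilon>0$ and $t>0$ there is $k_0\in\mathbb{N}$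 such that $\mu(u_k-a,t)>1-\varepsilon$ and $\nu(u_k-a,t)<\varepsilon$ for all $k\ge k_0$. A sequence $(v_k)$ in $N$ is statistically convergent to $a\in N$ with respect to $(\mu,\nu)$ if for every $\varepsilon>0$ and $t>0$, $\lim_{n\to\infty}\frac1n\left|\{k\le n:\mu(v_k-a,t)\le 1-\varepsilon\text{ or }\nu(v_k-a,t)\ge\varepsilon\}\right|=0$. The Hölder means of $(u_k)$ are defined recursively by $H^0_k=u_k$ and $H^m_k=\frac1k\sum_{j=1}^kH^{m-1}_j$ for $m\ge 1$. $(u_k)$ is statistically $(H,m)$ summable to $a$ if the sequence $(H^m_k)_{k\ge1}$ is statistically convergent to $a$. A sequence $(v_k)$ in $N$ is q-bounded if $\lim_{t\to\infty}\inf_{k}\mu(v_k,t)=1$ and $\lim_{t\to\infty}\sup_{k}\nu(v_k,t)=0$. In $\{k(u_k-u_{k-1})\}$ the convention $u_0=\theta$ is used. *)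

(* Defs.v *)
From mathcomp Require Import all_boot all_order all_algebra.
From mathcomp Require Import all_classical all_reals all_analysis.
Import Order.TTheory GRing.Theory Num.Theory.
Import numFieldNormedType.Exports.
Set Implicit Arguments.
Unset Strict Implicit.
Unset Printing Implicit Defensive.
Local Open Scope classical_set_scope.
Local Open Scope ring_scope.

(* [t --> 0^'] is the two-sided limit at 0 over punctured neighborhoods. *)
Record is_ifns (R : realType) (N : lmodType R) (mu nu : N -> R -> R) : Prop :=
  IsIFNS {
  ifns_mu01 : forall (u : N) (t : R), 0 <= mu u t <= 1;
  ifns_nu01 : forall (u : N) (t : R), 0 <= nu u t <= 1;
  ifns_mu_le0 : forall (u : N) (t : R), t <= 0 -> mu u t = 0;
  ifns_mu_eq1 : forall u : N, (forall t : R, 0 < t -> mu u t = 1) <-> u = 0;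
  ifns_muZ : forall (c : R) (u : N) (t : R), 0 < t -> c != 0 ->
    mu (c *: u) t = mu u (t / `|c|);
  ifns_muD : forall (u w : N) (t s : R),
    Num.min (mu u t) (mu w s) <= mu (u + w) (t + s);
  ifns_mu_pinfty : forall u : N, mu u t @[t --> +oo] --> (1 : R);
  ifns_mu_0 : forall u : N, u != 0 -> mu u t @[t --> 0^'] --> (0 : R);
  ifns_nu_le0 : forall (u : N) (t : R), t <= 0 -> nu u t = 1;
  ifns_nu_eq0 : forall u : N, (forall t : R, 0 < t -> nu u t = 0) <-> u = 0;
  ifns_nuZ : forall (c : R) (u : N) (t : R), 0 < t -> c != 0 ->
    nu (c *: u) t = nu u (t / `|c|);
  ifns_nuD : forall (u w : N) (t s : R),
    nu (u + w) (t + s) <= Num.max (nu u t) (nu w s);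
  ifns_nu_pinfty : forall u : N, nu u t @[t --> +oo] --> (0 : R);
  ifns_nu_0 : forall u : N, u != 0 -> nu u t @[t --> 0^'] --> (1 : R)
}.

(* A sequence (u_k)_{k >= 1} is a function [u : nat -> N] whose value at index
   0 is junk: no property of sequences below depends on [u 0]. *)

Definition ifn_converges (R : realType) (N : lmodType R) (mu nu : N -> R -> R)
    (u : nat -> N) (a : N) : Prop :=
  forall eps t : R, 0 < eps -> 0 < t ->
  exists k0 : nat, forall k : nat, (k0 <= k)%N ->
    1 - eps < mu (u k - a) t /\ nu (u k - a) t < eps.

Definition ifn_stat_converges (R : realType) (N : lmodType R)
    (mu nu : N -> R -> R) (v : nat -> N) (a : N) : Prop :=
  forall eps t : R, 0 < eps -> 0 < t ->
  n%:R^-1 * (count (fun k => (mu (v k - a) t <= 1 - eps)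
                             || (eps <= nu (v k - a) t))
                   (index_iota 1 n.+1))%:R @[n --> \oo] --> (0 : R).

Fixpoint holder_mean (R : realType) (N : lmodType R) (u : nat -> N)
    (m k : nat) : N :=
  if m is m'.+1
  then k%:R^-1 *: \sum_(1 <= j < k.+1) holder_mean u m' j
  else u k.

Definition stat_holder_summable (R : realType) (N : lmodType R)
    (mu nu : N -> R -> R) (m : nat) (u : nat -> N) (a : N) : Prop :=
  ifn_stat_converges mu nu (holder_mean u m) a.

(* The infimum and supremum are taken in R; for an IFNS the sets involved are
   nonempty subsets of [0, 1]. *)
Definition q_bounded (R : realType) (N : lmodType R) (mu nu : N -> R -> R)
    (v : nat -> N) : Prop :=
  inf [set mu (v k) t | k in [set k | (1 <= k)%N]] @[t --> +oo] --> (1 : R) /\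
  sup [set nu (v k) t | k in [set k | (1 <= k)%N]] @[t --> +oo] --> (0 : R).

(* k (u_k - u_{k-1}), with u_0 replaced by the zero vector. *)
Definition scaled_diff (R : realType) (N : lmodType R) (u : nat -> N)
    (k : nat) : N :=
  k%:R *: (u k - (if k.-1 == 0%N then 0 else u k.-1)).

(* Main.v *)
(* For each eps in (0, 1], the infimum p x of the t with mu x t > 1 - eps and
   nu x t < eps is a real seminorm: the minimum and maximum in the triangle
   axioms make it subadditive. Convergence, statistical convergence and
   q-boundedness turn into the same notions for p, so the theorem reduces to a
   Tauberian theorem for a seminorm.
   There, the condition p (v_(k+1) - v_k) <= M / k passes to Cesaro means with
   the same M, and makes p (v_(n+i) - v_n) at most M / q for i <= n / q. Such a
   window n < j <= n + n / q cannot consist of indices of a density-zero set,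
   so statistical convergence of the m-th Holder means implies convergence.
   Comparing v_n with the average of v over the window then recovers the
   convergence of v from that of its Cesaro means, and m such steps lead from
   the m-th Holder means down to the sequence itself. *)
Require Import Defs.
From mathcomp Require Import all_boot all_order all_algebra.
From mathcomp Require Import all_classical all_reals all_analysis.
From mathcomp Require Import lra.
Import Order.TTheory GRing.Theory Num.Theory.
Import numFieldNormedType.Exports.
Set Implicit Arguments.
Unset Strict Implicit.
Unset Printing Implicit Defensive.
Local Open Scope classical_set_scope.
Local Open Scope ring_scope.

(** * A Tauberian theorem for a real seminorm *)

Record is_seminorm (R : realType) (N : lmodType R) (p : N -> R) : Prop :=
  IsSeminorm {
  seminormD : forall x y : N, p (x + y) <= p x + p y;
  seminormZ : forall (c : R) (x : N), p (c *: x) <= `|c| * p x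
}.

Definition seminorm_converges (R : realType) (N : lmodType R) (p : N -> R)
    (v : nat -> N) (a : N) : Prop :=
  forall e : R, 0 < e ->
  exists n0 : nat, forall n : nat, (n0 <= n)%N -> p (v n - a) <= e.

Definition seminorm_stat_converges (R : realType) (N : lmodType R)
    (p : N -> R) (v : nat -> N) (a : N) : Prop :=
  forall t e : R, 0 < t -> 0 < e ->
  exists n0 : nat, forall n : nat, (n0 <= n)%N ->
    (count (fun k => t <= p (v k - a)) (index_iota 1 n.+1))%:R <= e * n%:R.

(** Differences are taken forward from index 1, which keeps the junk value [v 0] out. *)
Definition slowly_varying (R : realType) (N : lmodType R) (p : N -> R)
    (M : R) (v : nat -> N) : Prop :=
  forall k : nat, (0 < k)%N -> p (v k.+1 - v k) <= M / k%:R.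

Section Seminorm.
Context (R : realType) (N : lmodType R) (p : N -> R).
Context (p_seminorm : is_seminorm p).
Implicit Types (v : nat -> N) (x y a : N) (M : R).

Lemma seminorm0 : p 0 <= 0.
Proof. by have := seminormZ p_seminorm 0 0; rewrite scale0r normr0 mul0r. Qed.

Lemma seminormN x : p (- x) <= p x.
Proof.
by have := seminormZ p_seminorm (-1) x; rewrite scaleN1r normrN1 mul1r.
Qed.

Lemma seminorm_ge0 x : 0 <= p x.
Proof.
have := seminormD p_seminorm x (- x).
have := seminormD p_seminorm 0 0.
have := seminormN x; rewrite subrr addr0; lra.
Qed.

Lemma seminormZn (n : nat) x : p (n%:R *: x) <= n%:R * p x.
Proof. by have := seminormZ p_seminorm n%:R x; rewrite normr_nat. Qed.

Lemma slowly_varying_ge0 {M v} : slowly_varying p M v -> 0 <= M.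
Proof.
by move=> /(_ 1 isT); rewrite divr1; apply: le_trans; exact: seminorm_ge0.
Qed.

(** Each of the i steps from n to n + i costs at most M / n, its index being at least n. *)
Lemma slowly_varying_window {M v} (n i : nat) : slowly_varying p M v ->
  (0 < n)%N -> p (v (n + i)%N - v n) <= i%:R * (M / n%:R).
Proof.
move=> vM n0; have M0 := slowly_varying_ge0 vM.
elim: i => [|i IH]; first by rewrite addn0 subrr mul0r seminorm0.
rewrite addnS -natr1 mulrDl mul1r.
have -> : v (n + i).+1 - v n
    = (v (n + i)%N - v n) + (v (n + i).+1 - v (n + i)%N).
  by rewrite [RHS]addrC addrA subrK.
apply: le_trans (seminormD p_seminorm _ _) _; apply: lerD => //.
apply: le_trans (vM _ _) _; first by rewrite addn_gt0 n0.
apply: ler_wpM2l => //.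
by rewrite lef_pV2 ?posrE ?ltr0n ?addn_gt0 ?n0 // ler_nat leq_addr.
Qed.

(** Abel summation: the vector is the sum of k (v_(k+1) - v_k) over 0 < k < n, and each term has
    seminorm at most M. *)
Lemma slowly_varying_mean_gap {M v} (n : nat) : slowly_varying p M v ->
  p (n%:R *: v n - \sum_(1 <= j < n.+1) v j) <= n%:R * M.
Proof.
move=> vM; elim: n => [|n IH].
  by rewrite big_geq // scale0r subrr mul0r seminorm0.
rewrite big_nat_recr //= -!natr1 scalerDl scale1r mulrDl mul1r.
have -> : n%:R *: v n.+1 + v n.+1 - (\sum_(1 <= j < n.+1) v j + v n.+1)
  = (n%:R *: v n - \sum_(1 <= j < n.+1) v j) + n%:R *: (v n.+1 - v n).
  rewrite opprD addrACA addrN addr0 scalerBr [RHS]addrC.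
  by rewrite [RHS]addrA subrK.
apply: le_trans (seminormD p_seminorm _ _) _; apply: lerD => //.
apply: le_trans (seminormZn _ _) _.
case: n {IH} => [|n]; first by rewrite mul0r (slowly_varying_ge0 vM).
by rewrite mulrC -ler_pdivlMr ?ltr0n // vM.
Qed.

(* With S the partial sums, (k+1) (S_(k+1)/(k+1) - S_k/k) is v_(k+1) - v_k plus
   1/k times the gap k v_k - S_k, which is at most k M. *)
Lemma slowly_varying_mean {M v} : slowly_varying p M v ->
  slowly_varying p M (fun k => k%:R^-1 *: \sum_(1 <= j < k.+1) v j).
Proof.
move=> vM k k0; have M0 := slowly_varying_ge0 vM.
have kn0 : k%:R != 0 :> R by rewrite pnatr_eq0 -lt0n.
have k1n0 : k.+1%:R != 0 :> R by rewrite pnatr_eq0.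
set S := \sum_(1 <= j < k.+1) v j.
have -> : k.+1%:R^-1 *: \sum_(1 <= j < k.+2) v j - k%:R^-1 *: S
   = k.+1%:R^-1 *: (v k.+1 - v k + k%:R^-1 *: (k%:R *: v k - S)).
  rewrite big_nat_recr //= -/S.
  apply: (scalerI k1n0); rewrite scalerBr !scalerA !divff // !scale1r.
  rewrite scalerBr scalerA mulVf // scale1r addrA subrK.
  rewrite -natr1 mulrDl mul1r divff // scalerDl scale1r opprD addrA.
  by rewrite [S + _]addrC addrK.
apply: le_trans (seminormZ p_seminorm _ _) _.
rewrite ger0_norm ?invr_ge0 ?ler0n // mulrC ler_pdivrMr ?ltr0n //.
have -> : M / k%:R * k.+1%:R = M / k%:R + M.
  by rewrite -natr1 mulrDr mulr1 -mulrA mulVf // mulr1 addrC.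
apply: le_trans (seminormD p_seminorm _ _) _; apply: lerD; first exact: vM.
apply: le_trans (seminormZ p_seminorm _ _) _.
rewrite ger0_norm ?invr_ge0 ?ler0n // mulrC ler_pdivrMr ?ltr0n // mulrC.
exact: slowly_varying_mean_gap.
Qed.

(** The vector is the sum of v_(n+r) - v_n over 1 <= r <= i, and each term is at most i M / n. *)
Lemma slowly_varying_sum_window {M v} (n i : nat) : slowly_varying p M v ->
  (0 < n)%N ->
  p (\sum_(1 <= j < (n + i).+1) v j - \sum_(1 <= j < n.+1) v j - i%:R *: v n)
    <= i%:R * (i%:R * (M / n%:R)).
Proof.
move=> vM n0.
have Mn0 : 0 <= M / n%:R by rewrite divr_ge0 // (slowly_varying_ge0 vM).
elim: i => [|i IH].
  by rewrite addn0 subrr scale0r subrr mul0r seminorm0.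
set S := \sum_(1 <= j < n.+1) v j in IH *.
rewrite addnS big_nat_recr //=.
set T := \sum_(1 <= j < (n + i).+1) v j in IH *.
have -> : T + v (n + i).+1 - S - i.+1%:R *: v n =
  (T - S - i%:R *: v n) + (v (n + i).+1 - v n).
  by rewrite -natr1 scalerDl scale1r opprD [T + _ - S]addrAC addrACA.
apply: le_trans (seminormD p_seminorm _ _) _.
have := slowly_varying_window i.+1 vM n0; rewrite addnS.
have i0 : 0 <= i%:R :> R by [].
rewrite -natr1; nra.
Qed.

Lemma exists_nat_mul_ge {M} {e : R} : 0 <= M -> 0 < e ->
  exists2 q : nat, (0 < q)%N & M <= q%:R * e.
Proof.
move=> M0 e0; exists (Num.bound (M / e)).+1 => //.
rewrite -ler_pdivrMr //; apply/ltW/(lt_trans (archi_boundP _)).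
  by rewrite divr_ge0 // ltW.
by rewrite ltr_nat.
Qed.

(** For a window of length h = [n %/ q], the upper bound on h q gives h M / n <= M / q, and the
    lower one keeps n below a fixed multiple of h. The factor 2 absorbs the remainder, which is less
    than q <= h q. *)
Lemma divn_window {q n : nat} : (0 < q)%N -> (q <= n)%N ->
  [/\ (0 < n %/ q)%N, (n %/ q)%:R * q%:R <= n%:R :> R
     & n%:R <= 2 * ((n %/ q)%:R * q%:R) :> R].
Proof.
move=> q0 qn; have h0 : (0 < n %/ q)%N by rewrite divn_gt0.
split => //; rewrite -?natrM ler_nat; first exact: leq_divM.
rewrite {1}(divn_eq n q) mul2n -addnn leq_add2l.
by rewrite (leq_trans (ltnW (ltn_pmod n q0))) // leq_pmull.
Qed.

Lemma seminorm_converges_mean {M v a} : slowly_varying p M v ->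
  seminorm_converges p (fun k => k%:R^-1 *: \sum_(1 <= j < k.+1) v j) a ->
  seminorm_converges p v a.
Proof.
move=> vM va e e0; have M0 := slowly_varying_ge0 vM.
have [q q0 qM] := exists_nat_mul_ge M0 (divr_gt0 e0 (ltr0n R 2)).
have q0' : 0 < q%:R :> R by rewrite ltr0n.
(* As n <= 2 h q, the Cesaro errors at n and n + h together cost at most (2 n + h) d <= (4 q + 1) h
   d = h e / 2. *)
pose d : R := e / (2 * (4 * q%:R + 1)).
have d0 : 0 < d by rewrite divr_gt0 //; lra.
have dE : 2 * (4 * q%:R + 1) * d = e.
  by rewrite /d mulrC divfK //; apply/eqP; lra.
have [n0 n0P] := va d d0.
exists (maxn n0 q) => n; rewrite geq_max => /andP[n0n qn].
have n_gt0 : (0 < n)%N := leq_trans q0 qn.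
have n_gt0' : 0 < n%:R :> R by rewrite ltr0n.
have [h0 hqn nhq] := divn_window q0 qn.
set h := (n %/ q)%N in h0 hqn nhq *.
have h0' : 0 < h%:R :> R by rewrite ltr0n.
pose S k := \sum_(1 <= j < k.+1) v j.
have Sa k : (0 < k)%N -> (n0 <= k)%N -> p (S k - k%:R *: a) <= k%:R * d.
  move=> k0 n0k; have -> : S k - k%:R *: a = k%:R *: (k%:R^-1 *: S k - a).
    by rewrite scalerBr scalerA divff ?scale1r // pnatr_eq0 -lt0n.
  by apply: le_trans (seminormZn _ _) _; rewrite ler_wpM2l // n0P.
(* The first summand compares h v_n with the sum over the window; the second is the difference of
   the Cesaro errors at its two ends. *)
have key : h%:R *: (v n - a) = - (S (n + h)%N - S n - h%:R *: v n)
    + ((S (n + h)%N - (n + h)%:R *: a) - (S n - n%:R *: a)).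
  rewrite natrD scalerDl.
  have -> : S (n + h)%N - (n%:R *: a + h%:R *: a) - (S n - n%:R *: a)
      = (S (n + h)%N - S n) - h%:R *: a.
    by rewrite [- (S n - _)]opprD addrACA -opprD [_ *: a + _]addrC addrK.
  by rewrite scalerBr opprB subrKA.
have ph : p (v n - a) <= h%:R^-1 * p (h%:R *: (v n - a)).
  have := seminormZ p_seminorm h%:R^-1 (h%:R *: (v n - a)).
  rewrite scalerA mulVf ?scale1r ?lt0r_neq0 //.
  by rewrite ger0_norm // invr_ge0 ltW.
apply: le_trans ph _; rewrite mulrC ler_pdivrMr // key.
apply: le_trans (seminormD p_seminorm _ _) _.
have := seminormN (S (n + h)%N - S n - h%:R *: v n).
have := slowly_varying_sum_window h vM n_gt0.
rewrite -/(S n) -/(S (n + h)%N).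
have := seminormD p_seminorm (S (n + h)%N - (n + h)%:R *: a)
  (- (S n - n%:R *: a)).
have := seminormN (S n - n%:R *: a).
have := Sa n n_gt0 n0n.
have := Sa (n + h)%N.
rewrite addn_gt0 n_gt0 => /(_ isT (leq_trans n0n (leq_addr _ _))).
rewrite natrD.
have hM : h%:R * (M / n%:R) <= e / 2.
  by rewrite mulrA ler_pdivrMr //; nra.
have : h%:R * (h%:R * (M / n%:R)) <= h%:R * (e / 2) by rewrite ler_wpM2l // ltW.
have : (2 * n%:R + h%:R) * d <= h%:R * (e / 2) by rewrite -dE; nra.
nra.
Qed.

Lemma seminorm_stat_converges_slowly_varying {M v a} : slowly_varying p M v ->
  seminorm_stat_converges p v a -> seminorm_converges p v a.
Proof.
move=> vM va e e0; have M0 := slowly_varying_ge0 vM.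
have e20 : 0 < e / 2 by rewrite divr_gt0.
have [q q0 qM] := exists_nat_mul_ge M0 e20.
have q0' : 0 < q%:R :> R by rewrite ltr0n.
(* A window without a good index would give h <= d (n + h) <= d (2 q + 1) h = h / 2. *)
pose d : R := (2 * (2 * q%:R + 1))^-1.
have d0 : 0 < d by rewrite invr_gt0 //; lra.
have dE : 2 * (2 * q%:R + 1) * d = 1 by rewrite divff //; apply/eqP; lra.
have [n0 n0P] := va (e / 2) d e20 d0.
exists (maxn n0 q) => n; rewrite geq_max => /andP[n0n qn].
have n_gt0 : (0 < n)%N := leq_trans q0 qn.
have n_gt0' : 0 < n%:R :> R by rewrite ltr0n.
have [h0 hqn nhq] := divn_window q0 qn.
set h := (n %/ q)%N in h0 hqn nhq *.
have h0' : 0 < h%:R :> R by rewrite ltr0n.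
have hM : h%:R * (M / n%:R) <= e / 2.
  by rewrite mulrA ler_pdivrMr //; nra.
have [j /andP[nj jnh] jP] : exists2 j, (n < j <= n + h)%N & p (v j - a) < e / 2.
  have := n0P (n + h)%N (leq_trans n0n (leq_addr _ _)).
  have -> : index_iota 1 (n + h).+1 = iota 1 n ++ iota n.+1 h.
    by rewrite /index_iota subn1 iotaD.
  rewrite count_cat; set P := fun k => _.
  have [/allP PP|/allPn[j]] := boolP (all P (iota n.+1 h)).
    have -> : count P (iota n.+1 h) = h.
      rewrite -[RHS](size_iota n.+1 h); apply/eqP.
      by rewrite -all_count; apply/allP.
    rewrite natrD natrD => bad; exfalso.
    have c0 : 0 <= (count P (iota 1 n))%:R :> R by [].
    nra.
  rewrite mem_iota addSn ltnS => jn; rewrite /P -ltNge => jP _.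
  by exists j.
have -> : v n - a = - (v j - v n) + (v j - a) by rewrite opprB addrA subrK.
apply: le_trans (seminormD p_seminorm _ _) _.
have := seminormN (v j - v n).
have := slowly_varying_window (j - n) vM n_gt0; rewrite subnKC ?(ltnW nj) //.
have : (j - n)%:R * (M / n%:R) <= h%:R * (M / n%:R).
  by rewrite ler_wpM2r ?divr_ge0 // ler_nat leq_subLR.
lra.
Qed.

Lemma slowly_varying_holder_mean {M v} (m : nat) : slowly_varying p M v ->
  slowly_varying p M (holder_mean v m).
Proof. by move=> vM; elim: m => // m; exact: slowly_varying_mean. Qed.

Lemma seminorm_stat_holder_tauberian {M v a} (m : nat) :
  slowly_varying p M v -> seminorm_stat_converges p (holder_mean v m) a ->
  seminorm_converges p v a.
Proof.
move=> vM st.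
(* The statistical hypothesis is spent at level m; the induction then descends with ordinary
   convergence. *)
have := seminorm_stat_converges_slowly_varying
  (slowly_varying_holder_mean m vM) st.
elim: m {st} => // m IH cv; apply: IH.
exact: seminorm_converges_mean (slowly_varying_holder_mean m vM) cv.
Qed.

End Seminorm.

(* For [0 < eps <= 1] and an IFNS the set is nonempty and bounded below by 0, so
   the infimum is never the junk value of [inf]. *)
Definition ifn_gauge (R : realType) (N : lmodType R) (mu nu : N -> R -> R)
    (eps : R) (x : N) : R :=
  inf [set t | 1 - eps < mu x t /\ nu x t < eps].

(** * The gauges of an intuitionistic fuzzy norm *)

Section Gauge.
Context (R : realType) (N : lmodType R) (mu nu : N -> R -> R).
Context (NN : is_ifns mu nu) (eps : R) (eps0 : 0 < eps) (eps1 : eps <= 1).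
Implicit Types (x y a : N) (s t : R).

Local Notation ball x := [set t | 1 - eps < mu x t /\ nu x t < eps].
Local Notation p := (ifn_gauge mu nu eps).

(** For t <= 0 membership would force 1 - eps < 0, against [eps1]. This bounds the sets below, so
    their infima make sense. *)
Lemma ifn_ball_gt0 x t : ball x t -> 0 < t.
Proof.
move=> [mxt _]; rewrite ltNge; apply/negP => t_le0.
have m0 := ifns_mu_le0 NN x t_le0.
by move: mxt; rewrite m0 subr_lt0 ltNge eps1.
Qed.

Lemma ifn_ballD x y s t : ball x s -> ball y t -> ball (x + y) (s + t).
Proof.
move=> [mx nx] [my ny]; split.
  by apply: lt_le_trans (ifns_muD NN x y s t); rewrite lt_min mx my.
by apply: le_lt_trans (ifns_nuD NN x y s t) _; rewrite gt_max nx ny.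
Qed.

Lemma ifn_ball0 t : 0 < t -> ball 0 t.
Proof.
move=> t0; split.
  by rewrite ((ifns_mu_eq1 NN 0).2 erefl) // ltrBlDr ltrDl.
by rewrite ((ifns_nu_eq0 NN 0).2 erefl).
Qed.

(** Monotonicity in t is not an axiom; it comes from adding the zero vector with parameter t - s. *)
Lemma ifn_ball_lt x s t : s < t -> ball x s -> ball x t.
Proof.
move=> st xs; have t_s : 0 < t - s by rewrite subr_gt0.
by have := ifn_ballD xs (ifn_ball0 t_s); rewrite addr0 subrKC.
Qed.

Lemma ifn_ballZ (c : R) x t : c != 0 -> ball x t -> ball (c *: x) (`|c| * t).
Proof.
move=> c0 xt; have t0 := ifn_ball_gt0 xt.
have c0' : 0 < `|c| by rewrite normr_gt0.
have ct0 : 0 < `|c| * t by rewrite mulr_gt0.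
rewrite /= (ifns_muZ NN) // (ifns_nuZ NN) //.
by rewrite mulrAC divff ?mul1r ?lt0r_neq0.
Qed.

Lemma ifn_ball_nonempty x : ball x !=set0.
Proof.
suff : \forall t \near +oo, ball x t by move/filter_ex.
have e1 : 1 - eps < 1 by rewrite ltrBlDr ltrDl.
near=> t; split; near: t.
  exact: (cvgr_gt _ (ifns_mu_pinfty NN x) _ e1).
exact: (cvgr_lt _ (ifns_nu_pinfty NN x) _ eps0).
Unshelve. all: by end_near. Qed.

Lemma ifn_gauge_le x t : ball x t -> p x <= t.
Proof.
by move=> xt; apply: ge_inf => //; exists 0 => s /ifn_ball_gt0 /ltW.
Qed.

(** The inequality is strict because the infimum need not be attained. *)
Lemma ifn_gauge_lt x t : p x < t -> ball x t.
Proof.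
move=> pxt; have [s xs st] := inf_lt (ifn_ball_nonempty x) pxt.
exact: ifn_ball_lt st xs.
Qed.

Lemma ifn_gauge_seminorm : is_seminorm p.
Proof.
split=> [x y|c x].
  apply/ler_addgt0Pr => e e0.
  have e20 : 0 < e / 2 by rewrite divr_gt0.
  have xe : ball x (p x + e / 2) by apply: ifn_gauge_lt; lra.
  have ye : ball y (p y + e / 2) by apply: ifn_gauge_lt; lra.
  by apply: le_trans (ifn_gauge_le (ifn_ballD xe ye)) _; lra.
(* The scaling axioms exclude c = 0; there, every positive t lies in [ball 0]. *)
have [->|c0] := eqVneq c 0.
  rewrite scale0r normr0 mul0r; apply/ler_addgt0Pr => e e0.
  by rewrite add0r; exact/ifn_gauge_le/ifn_ball0.
have c0' : 0 < `|c| by rewrite normr_gt0.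
rewrite mulrC -ler_pdivrMr //; apply/ler_addgt0Pr => e e0.
rewrite ler_pdivrMr // mulrC.
by apply/ifn_gauge_le/ifn_ballZ => //; apply: ifn_gauge_lt; lra.
Qed.

(** An index that is good at t / 2 has gauge at most t / 2 < t, so the indices counted for the gauge
    at t are among the bad ones at t / 2. *)
Lemma ifn_gauge_stat_converges (v : nat -> N) a :
  ifn_stat_converges mu nu v a -> seminorm_stat_converges p v a.
Proof.
move=> va t e t0 e0; have t20 : 0 < t / 2 by rewrite divr_gt0.
have [n0 _ n0P] := cvgr_lt _ (va eps (t / 2) eps0 t20) _ e0.
exists n0.+1 => n n0n; have n_gt0 : 0 < n%:R :> R.
  by rewrite ltr0n (leq_trans _ n0n).
have /ltW := n0P n (ltnW n0n).
rewrite /= mulrC ler_pdivrMr //; apply: le_trans; rewrite ler_nat.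
apply: sub_count => k; apply: contraTT; rewrite negb_or -!ltNge => /andP[mk nk].
by apply: le_lt_trans (ifn_gauge_le (t := t / 2) _) _; [split|lra].
Qed.

(** One large parameter lies in the balls of all v_k with k >= 1 and serves as M. *)
Lemma ifn_gauge_q_bounded (v : nat -> N) : q_bounded mu nu v ->
  exists M : R, forall k, (0 < k)%N -> p (v k) <= M.
Proof.
move=> [vmu vnu]; have e1 : 1 - eps < 1 by rewrite ltrBlDr ltrDl.
pose I := [set k : nat | (1 <= k)%N].
have : \forall t \near +oo, 1 - eps < inf [set mu (v k) t | k in I]
                            /\ sup [set nu (v k) t | k in I] < eps.
  near=> t; split; near: t; first exact: (cvgr_gt _ vmu _ e1).
  exact: (cvgr_lt _ vnu _ eps0).
move=> /filter_ex[M [muM nuM]]; exists M => k k0; apply: ifn_gauge_le; split.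
  apply: lt_le_trans muM _; apply: ge_inf; last by exists k.
  by exists 0 => _ [j _ <-]; have /andP[] := ifns_mu01 NN (v j) M.
apply: le_lt_trans nuM; apply: ub_le_sup; last by exists k.
by exists 1 => _ [j _ <-]; have /andP[] := ifns_nu01 NN (v j) M.
Unshelve. all: by end_near. Qed.

Lemma ifn_gauge_slowly_varying (u : nat -> N) :
  q_bounded mu nu (scaled_diff u) -> exists M : R, slowly_varying p M u.
Proof.
move=> /ifn_gauge_q_bounded[M uM]; exists M => k k0.
have k0' : 0 < k%:R :> R by rewrite ltr0n.
(* As k > 0, [x] is u_(k+1) - u_k; its bound M / (k + 1) is then weakened to M / k. *)
have := uM k.+1 isT; rewrite /scaled_diff /= gtn_eqF //; set x := _ - _ => xM.
have M0 : 0 <= M := le_trans (seminorm_ge0 ifn_gauge_seminorm _) xM.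
have -> : x = k.+1%:R^-1 *: (k.+1%:R *: x).
  by rewrite scalerA mulVf ?scale1r // pnatr_eq0.
apply: le_trans (seminormZ ifn_gauge_seminorm _ _) _.
rewrite ger0_norm ?invr_ge0 ?ler0n // mulrC.
apply: le_trans (_ : M / k.+1%:R <= _).
  by rewrite ler_wpM2r // invr_ge0.
by rewrite ler_wpM2l // lef_pV2 ?posrE ?ltr0n // ler_nat.
Qed.

Lemma ifn_gauge_holder_tauberian (u : nat -> N) a (m : nat) :
  stat_holder_summable mu nu m u a -> q_bounded mu nu (scaled_diff u) ->
  seminorm_converges p u a.
Proof.
move=> /ifn_gauge_stat_converges ua /ifn_gauge_slowly_varying[M uM].
exact: (seminorm_stat_holder_tauberian ifn_gauge_seminorm uM ua).
Qed.

End Gauge.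

Theorem theorem2p11 (R : realType) (N : lmodType R) (mu nu : N -> R -> R)
    (u : nat -> N) (a : N) (m : nat) :
  is_ifns mu nu ->
  (1 <= m)%N ->
  stat_holder_summable mu nu m u a ->
  q_bounded mu nu (scaled_diff u) ->
  ifn_converges mu nu u a.
Proof.
move=> NN _ ua uq eps t eps0 t0.
(* Capping at 1 puts the level in the range where the gauge is a seminorm, and a smaller level only
   strengthens the conclusion. *)
pose e := Num.min eps 1.
have e0 : 0 < e by rewrite lt_min eps0 ltr01.
have e1 : e <= 1 by rewrite ge_min lexx orbT.
have e_eps : e <= eps by rewrite ge_min lexx.
(* Halving t provides the strict inequality that [ifn_gauge_lt] requires. *)
have t20 : 0 < t / 2 by rewrite divr_gt0.
have [k0 k0P] := ifn_gauge_holder_tauberian NN e0 e1 ua uq t20.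
exists k0 => k /k0P kP.
have kt : ifn_gauge mu nu e (u k - a) < t by apply: le_lt_trans kP _; lra.
by have [muk nuk] := ifn_gauge_lt NN e0 kt; split; lra.
Qed.
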